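(* Let $A$ be a Frobenius algebra over a field $K$, regarded as a coalgebra via its Frobenius comultiplication $\delta$ and counit $\epsilon$. Then the category of right $A$-modules is isomorphic to the category of right $A$-comodules.
   Context: All tensor products are over $K$. Algebras are finite-dimensional over $K$ and unital, not necessarily commutative. $A$ is a Frobenius algebra if it is equipped with an isomorphism of left $A$-modules $\lambda_L\colon A\to A^*$, where $(a\cdot\zeta)(b):=\zeta(ba)$ for $a,b\in A$, $\zeta\in A^*$. Put $\epsilon:=\lambda_L(1_A)\colon A\to K$. The Frobenius comultiplication is $\delta:=(\lambda_L^{-1}\otimes\lambda_L^{-1})\circ\mu_T^*\circ\lambda_L\colon A\to A\otimes A$, where $\mu_T(a\otimes b)=ba$ and $(A\otimes A)^*$ is identified with $A^*\otimes A^*$. It is the coassociative comultiplication with counit $\epsilon$ that is a map of left $A^e$-modules, i.e. $\delta(bab')=b\,\delta(a)\,b'$ with $b(x\otimes y)b'=bx\otimes yb'$. Thus $(A,\delta,\epsilon)$ is a coalgebra, and right $A$-comodules are comodules over this coalgebra. *)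

(* Defs.v *)
From HB Require Import structures.
From mathcomp Require Import all_boot all_algebra.
From mathcomp Require Import falgebra boolp.
From mathcomp.multinomials Require Import freeg.

Set Implicit Arguments.
Unset Strict Implicit.
Unset Printing Implicit Defensive.

Import GRing.Theory.

Local Open Scope ring_scope.
Local Open Scope quotient_scope.

Record category := Category {
  ob :> Type;
  hom : ob -> ob -> Type;
  idm : forall X, hom X X;
  compm : forall X Y Z, hom Y Z -> hom X Y -> hom X Z;
  comp_idl : forall X Y (f : hom X Y), compm (idm Y) f = f;
  comp_idr : forall X Y (f : hom X Y), compm f (idm X) = f;
  compA : forall X Y Z T (f : hom Z T) (g : hom Y Z) (h : hom X Y),
    compm f (compm g h) = compm (compm f g) h }.

Arguments hom {c}.
Arguments idm {c}.
Arguments compm {c X Y Z}.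

Record functor (C D : category) := Functor {
  fobj :> C -> D;
  fmap : forall X Y : C, hom X Y -> hom (fobj X) (fobj Y);
  fmap_id : forall X, fmap (idm X) = idm (fobj X);
  fmap_comp : forall X Y Z (f : hom Y Z) (g : hom X Y),
    fmap (compm f g) = compm (fmap f) (fmap g) }.

Arguments fmap {C D} _ {X Y}.

Definition functor_id (C : category) : functor C C :=
  @Functor C C id (fun _ _ f => f) (fun _ => erefl) (fun _ _ _ _ _ => erefl).

Section FunctorComp.
Variables (C D E : category) (G : functor D E) (F : functor C D).

Lemma functor_comp_id X : fmap G (fmap F (idm X)) = idm (G (F X)).
Proof. by rewrite !fmap_id. Qed.

Lemma functor_comp_comp X Y Z (f : hom Y Z) (g : hom X Y) :
  fmap G (fmap F (compm f g)) = compm (fmap G (fmap F f)) (fmap G (fmap F g)).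
Proof. by rewrite !fmap_comp. Qed.

Definition functor_comp : functor C E :=
  Functor (fobj := fun X => G (F X)) (fmap := fun _ _ f => fmap G (fmap F f))
    functor_comp_id functor_comp_comp.
End FunctorComp.

(* Isomorphism of categories, not equivalence: the composites are equal to,   *)
(* not merely naturally isomorphic to, the identity functors.                 *)
Definition isomorphic_categories (C D : category) : Prop :=
  exists (F : functor C D) (G : functor D C),
    functor_comp G F = functor_id C /\ functor_comp F G = functor_id D.

Section Span.
Variables (K : fieldType) (U : lmodType K) (G : U -> Prop).

Inductive in_span : U -> Prop :=
| in_span0 : in_span 0
| in_spanD a u v : G u -> in_span v -> in_span (a *: u + v).

Definition span_pred : {pred U} := fun u => `[< in_span u >].

Lemma span_pred_submod_closed : submod_closed span_pred.
Proof.
split=> [|a u v /asboolP hu /asboolP hv]; first exact/asboolP/in_span0.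
apply/asboolP; elim: hu => [|b w x Gw _ IH]; first by rewrite scaler0 add0r.
by rewrite scalerDr scalerA -addrA; apply: in_spanD.
Qed.

HB.instance Definition _ :=
  GRing.isZmodClosed.Build U span_pred (GRing.submod_closedB span_pred_submod_closed).

Lemma span_predZ a u : u \in span_pred -> a *: u \in span_pred.
Proof. exact: (GRing.subsemimod_closedZ (GRing.submod_closed_semi span_pred_submod_closed)). Qed.

Lemma gen_in_span u : G u -> u \in span_pred.
Proof.
by move=> Gu; apply/asboolP; rewrite -[u]scale1r -[X in in_span X]addr0; apply: in_spanD => //; left.
Qed.
End Span.

Section LmodQuotient.
Variables (K : fieldType) (U : lmodType K) (G : U -> Prop).

Local Notation S := (span_pred G).

Definition lmod_quot : Type := Quotient.quot S.
HB.instance Definition _ := GRing.Zmodule.on lmod_quot.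

Definition lmod_pi (u : U) : lmod_quot := \pi_(Quotient.quot S) u.

Lemma lmod_pi_eq u v : lmod_pi u = lmod_pi v <-> u - v \in S.
Proof.
rewrite (Quotient.idealrBE S); split=> [/eqP //|/eqP //].
Qed.

Lemma lmod_pi_repr (x : lmod_quot) : lmod_pi (repr x) = x.
Proof. exact: reprK. Qed.

Lemma lmod_piB : {morph lmod_pi : u v / u - v}.
Proof. exact: (raddfB (\pi_(Quotient.quot S))). Qed.

Lemma lmod_piD : {morph lmod_pi : u v / u + v}.
Proof. exact: (raddfD (\pi_(Quotient.quot S))). Qed.

Definition lmod_quot_scale (a : K) (x : lmod_quot) : lmod_quot :=
  lmod_pi (a *: repr x).

Lemma lmod_quot_scaleE a u : lmod_quot_scale a (lmod_pi u) = lmod_pi (a *: u).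
Proof.
apply/lmod_pi_eq; rewrite -scalerBr span_predZ //.
by apply/lmod_pi_eq; rewrite lmod_pi_repr.
Qed.

Lemma lmod_quot_ind (P : lmod_quot -> Prop) :
  (forall u, P (lmod_pi u)) -> forall x, P x.
Proof. by move=> h x; rewrite -(lmod_pi_repr x). Qed.

Lemma lmod_quot_scalerA a b x :
  lmod_quot_scale a (lmod_quot_scale b x) = lmod_quot_scale (a * b) x.
Proof.
by elim/lmod_quot_ind: x => u; rewrite !lmod_quot_scaleE scalerA.
Qed.

Lemma lmod_quot_scale1r : left_id 1 lmod_quot_scale.
Proof. by elim/lmod_quot_ind=> u; rewrite lmod_quot_scaleE scale1r. Qed.

Lemma lmod_quot_scalerDr : right_distributive lmod_quot_scale +%R.
Proof.
move=> a; elim/lmod_quot_ind=> u; elim/lmod_quot_ind=> v.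
by rewrite -lmod_piD !lmod_quot_scaleE -lmod_piD scalerDr.
Qed.

Lemma lmod_quot_scalerDl x : {morph lmod_quot_scale^~ x : a b / a + b}.
Proof.
move=> a b; elim/lmod_quot_ind: x => u.
by rewrite !lmod_quot_scaleE -lmod_piD scalerDl.
Qed.

HB.instance Definition _ := GRing.Zmodule_isLmodule.Build K lmod_quot
  lmod_quot_scalerA lmod_quot_scale1r lmod_quot_scalerDr lmod_quot_scalerDl.

Lemma lmod_pi_is_linear : linear lmod_pi.
Proof. by move=> a u v; rewrite lmod_piD -lmod_quot_scaleE. Qed.

HB.instance Definition _ :=
  GRing.isLinear.Build K U lmod_quot *:%R lmod_pi lmod_pi_is_linear.
End LmodQuotient.

Definition is_bilinear (K : fieldType) (V W U : lmodType K) (f : V -> W -> U) :=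
  (forall w, linear (f^~ w)) /\ (forall v, linear (f v)).

Section BilinearTheory.
Variables (K : fieldType) (V W U : lmodType K) (f : V -> W -> U).
Hypothesis f_bilinear : is_bilinear f.

Lemma bilinDl y z w : f (y + z) w = f y w + f z w.
Proof. by have := f_bilinear.1 w 1 y z; rewrite !scale1r. Qed.

Lemma bilinDr y z w : f y (z + w) = f y z + f y w.
Proof. by have := f_bilinear.2 y 1 z w; rewrite !scale1r. Qed.

Lemma bilin0l w : f 0 w = 0.
Proof. by apply: (addIr (f 0 w)); rewrite -bilinDl !add0r. Qed.

Lemma bilin0r y : f y 0 = 0.
Proof. by apply: (addIr (f y 0)); rewrite -bilinDr !add0r. Qed.

Lemma bilinZl b y w : f (b *: y) w = b *: f y w.
Proof. by have := f_bilinear.1 w b y 0; rewrite !addr0 bilin0l addr0. Qed.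

Lemma bilinZr b y w : f y (b *: w) = b *: f y w.
Proof. by have := f_bilinear.2 y b w 0; rewrite !addr0 bilin0r addr0. Qed.
End BilinearTheory.

Definition free_space (K : fieldType) (T : choiceType) : lmodType K :=
  {freeg T / K}.

Definition free_gen (K : fieldType) (T : choiceType) (t : T) : free_space K T :=
  << t >>.

Section FreeSpace.
Variables (K : fieldType) (T : choiceType).
Local Notation F := (free_space K T).
Local Notation gen := (@free_gen K T).

Lemma free_space_ind (P : F -> Prop) :
  P 0 -> (forall a t x, P x -> P (a *: gen t + x)) -> forall x, P x.
Proof.
move=> P0 PD; apply: freeg_ind_dom0 => // a t x _ _ /(PD a t).
congr P; congr (_ + _); apply/eqP/freeg_eqP => u.
by rewrite coeffZ !coeffU mul1r.
Qed.

Variables (U : lmodType K) (f : T -> U).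

Definition free_lift (x : F) : U := fglift f x.

Lemma free_lift_gen t : free_lift (gen t) = f t.
Proof. by rewrite /free_lift liftU scale1r. Qed.

Lemma free_liftD : {morph free_lift : x y / x + y}.
Proof.
have fB : {morph free_lift : x y / x - y} by exact: lift_is_additive.
have f0 : free_lift 0 = 0 by rewrite -[X in free_lift X](subrr 0) fB subrr.
by move=> x y; rewrite -{1}[y]opprK -[- y]sub0r !fB f0 sub0r opprK.
Qed.

Lemma free_liftU a t : free_lift (a *: gen t) = a *: f t.
Proof.
rewrite -(liftU f); congr (fglift f _).
by apply/eqP/freeg_eqP => u; rewrite coeffZ !coeffU mul1r.
Qed.

Lemma free_lift_is_linear : linear free_lift.
Proof.
move=> a x y; rewrite free_liftD; congr (_ + _).
have f0 : free_lift 0 = 0 by apply: (addIr (free_lift 0)); rewrite -free_liftD !add0r.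
elim/free_space_ind: x => [|k t D IH]; first by rewrite scaler0 f0 scaler0.
by rewrite scalerDr !free_liftD IH scalerDr scalerA !free_liftU scalerA.
Qed.

HB.instance Definition _ :=
  GRing.isLinear.Build K F U *:%R free_lift free_lift_is_linear.
End FreeSpace.

Section Tensor.
Variables (K : fieldType) (V W : lmodType K).

Local Notation free := (free_space K (V * W)%type).
Local Notation gen v w := (@free_gen K (V * W)%type (v, w)).

Inductive tensor_relation : free -> Prop :=
| tensor_relDl v v' w :
    tensor_relation (gen (v + v') w - gen v w - gen v' w)
| tensor_relDr v w w' :
    tensor_relation (gen v (w + w') - gen v w - gen v w')
| tensor_relZl a v w :
    tensor_relation (gen (a *: v) w - a *: gen v w)
| tensor_relZr a v w :
    tensor_relation (gen v (a *: w) - a *: gen v w).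

Definition tensor : lmodType K := lmod_quot tensor_relation.

Definition tens (v : V) (w : W) : tensor :=
  lmod_pi tensor_relation (gen v w).

Lemma tens_bilinear : is_bilinear tens.
Proof.
have relE u : tensor_relation u -> lmod_pi tensor_relation u = 0.
  by move=> /gen_in_span hu; rewrite -(linear0 (lmod_pi _)); apply/lmod_pi_eq; rewrite subr0.
split=> [w|v] a x y; rewrite /tens.
  have /eqP := relE _ (tensor_relDl (a *: x) y w).
  rewrite !linearB /= -addrA -opprD subr_eq0 => /eqP ->; congr (_ + _).
  by have /eqP := relE _ (tensor_relZl a x w); rewrite linearB linearZ subr_eq0 => /eqP.
have /eqP := relE _ (tensor_relDr v (a *: x) y).
rewrite !linearB /= -addrA -opprD subr_eq0 => /eqP ->; congr (_ + _).
by have /eqP := relE _ (tensor_relZr a v x); rewrite linearB linearZ subr_eq0 => /eqP.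
Qed.

Lemma tensor_ind (P : tensor -> Prop) :
  P 0 -> (forall v w t, P t -> P (tens v w + t)) -> forall t, P t.
Proof.
move=> P0 PD; elim/lmod_quot_ind => x.
elim/free_space_ind: x => [|k [v w] D IH]; first by rewrite linear0.
by rewrite linearP /= -(bilinZl tens_bilinear); apply: PD.
Qed.

Section Lift.
Variables (U : lmodType K) (f : V -> W -> U).

(* Evaluates f on an arbitrary representative of t: linear, and independent of *)
(* the representative, only when f is bilinear.                               *)
Definition tensor_lift (t : tensor) : U :=
  free_lift (fun p => f p.1 p.2) (repr t).

Hypothesis f_bilinear : is_bilinear f.

Lemma tensor_lift_pi x :
  tensor_lift (lmod_pi tensor_relation x) = free_lift (fun p => f p.1 p.2) x.
Proof.
rewrite /tensor_lift; set h := free_lift _; apply/eqP; rewrite -subr_eq0.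
rewrite -linearB; apply/eqP.
have : repr (lmod_pi tensor_relation x) - x \in span_pred tensor_relation.
  by apply/lmod_pi_eq; rewrite lmod_pi_repr.
move=> /asboolP; elim=> [|a u v hu _ IH]; first by rewrite linear0.
rewrite linearP /= IH addr0; apply/eqP; rewrite scaler_eq0; apply/orP; right.
apply/eqP; case: hu => *; rewrite ?linearB /= ?linearZ_LR /= !free_lift_gen /=.
- by rewrite (bilinDl f_bilinear) -addrA -opprD subrr.
- by rewrite (bilinDr f_bilinear) -addrA -opprD subrr.
- by rewrite (bilinZl f_bilinear) scalerN subrr.
- by rewrite (bilinZr f_bilinear) scalerN subrr.
Qed.

Lemma tensor_liftE v w : tensor_lift (tens v w) = f v w.
Proof. by rewrite tensor_lift_pi free_lift_gen. Qed.

Lemma tensor_lift_is_linear : linear tensor_lift.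
Proof.
move=> a; elim/lmod_quot_ind => x; elim/lmod_quot_ind => y.
by rewrite -linearP !tensor_lift_pi linearP.
Qed.
End Lift.
End Tensor.

(* Keeps unification from unfolding tensor products to quotients. *)
Global Opaque tensor.

Lemma tensor_ext (K : fieldType) (V W U : lmodType K)
    (f g : {linear tensor V W -> U}) :
  (forall v w, f (tens v w) = g (tens v w)) -> f =1 g.
Proof.
move=> fg; elim/tensor_ind => [|v w t IH]; first by rewrite !linear0.
by rewrite !linearD IH fg.
Qed.

Lemma linear_eq (K : fieldType) (V W : lmodType K) (f g : {linear V -> W}) :
  f =1 g -> f = g.
Proof.
case: f g => [f [[fn] [fs]]] [g [[gn] [gs]]] /= /funext fg; subst g.
by congr (GRing.Linear.Pack (GRing.Linear.Class _ _)); congr (_ _);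
   apply: Prop_irrelevance.
Qed.

Section TensorMap.
Variables (K : fieldType) (V V' W W' : lmodType K).
Variables (f : {linear V -> V'}) (g : {linear W -> W'}).

Definition tensor_map : tensor V W -> tensor V' W' :=
  tensor_lift (fun v w => tens (f v) (g w)).

Lemma tensor_map_bilinear : is_bilinear (fun v w => tens (f v) (g w)).
Proof.
split=> [w|v] a x y; rewrite linearP /=.
  exact: (tens_bilinear _ _).1.
exact: (tens_bilinear _ _).2.
Qed.

HB.instance Definition _ := GRing.isLinear.Build K _ _ *:%R tensor_map
  (tensor_lift_is_linear tensor_map_bilinear).

Lemma tensor_mapE v w : tensor_map (tens v w) = tens (f v) (g w).
Proof. exact: (tensor_liftE tensor_map_bilinear). Qed.
End TensorMap.

Lemma tensor_map_id (K : fieldType) (V W : lmodType K) :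
  tensor_map (idfun : {linear V -> V}) (idfun : {linear W -> W}) =1 idfun.
Proof. by apply: tensor_ext => v w; rewrite /= tensor_mapE. Qed.

Lemma tensor_map_comp (K : fieldType) (V V' V'' W : lmodType K)
    (g : {linear V' -> V''}) (f : {linear V -> V'}) t :
  tensor_map g (idfun : {linear W -> W}) (tensor_map f idfun t) =
  tensor_map (g \o f) idfun t.
Proof.
move: t; apply: (@tensor_ext _ _ _ _ (tensor_map g idfun \o tensor_map f idfun)).
by move=> v w /=; rewrite !tensor_mapE.
Qed.

Section Associator.
Variables (K : fieldType) (U V W : lmodType K).

Definition tensor_assoc_aux (w : W) : tensor U V -> tensor U (tensor V W) :=
  tensor_lift (fun u v => tens u (tens v w)).

Lemma tensor_assoc_aux_bilinear w :
  is_bilinear (fun u v => tens u (tens v w) : tensor U (tensor V W)).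
Proof.
split=> [v|u] a x y; first exact: (tens_bilinear _ _).1.
by rewrite (tens_bilinear _ _).1 (tens_bilinear _ _).2.
Qed.

HB.instance Definition _ w := GRing.isLinear.Build K _ _ *:%R
  (tensor_assoc_aux w) (tensor_lift_is_linear (tensor_assoc_aux_bilinear w)).

Definition tensor_assoc : tensor (tensor U V) W -> tensor U (tensor V W) :=
  tensor_lift (fun t w => tensor_assoc_aux w t).

Lemma tensor_assoc_bilinear : is_bilinear (fun t w => tensor_assoc_aux w t).
Proof.
split=> [w|t] a x y; first by rewrite linearP.
elim/tensor_ind: t => [|u v t IH]; first by rewrite !linear0 addr0.
rewrite !(linearD (tensor_assoc_aux _)) /= IH scalerDr addrACA; congr (_ + _).
rewrite /tensor_assoc_aux !tensor_liftE; try exact: tensor_assoc_aux_bilinear.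
by rewrite (tens_bilinear _ _).2 (tens_bilinear _ _).2.
Qed.

HB.instance Definition _ := GRing.isLinear.Build K _ _ *:%R tensor_assoc
  (tensor_lift_is_linear tensor_assoc_bilinear).

Lemma tensor_assocE u v w :
  tensor_assoc (tens (tens u v) w) = tens u (tens v w).
Proof.
rewrite /tensor_assoc (tensor_liftE tensor_assoc_bilinear).
exact: (tensor_liftE (tensor_assoc_aux_bilinear w)).
Qed.
End Associator.

Section Unitors.
Variables (K : fieldType) (V : lmodType K).

Definition tensor_unitl : tensor K^o V -> V := 
  tensor_lift (fun (a : K^o) (v : V) => a *: v).

Definition tensor_unitr : tensor V K^o -> V := 
  tensor_lift (fun (v : V) (a : K^o) => a *: v).

Lemma tensor_unitl_bilinear : is_bilinear (fun (a : K^o) (v : V) => a *: v).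
Proof.
split=> [v|b] a x y; first by rewrite scalerDl scalerA.
by rewrite scalerDr !scalerA mulrC.
Qed.

Lemma tensor_unitr_bilinear : is_bilinear (fun (v : V) (a : K^o) => a *: v).
Proof. by case: tensor_unitl_bilinear => h1 h2; split. Qed.

HB.instance Definition _ := GRing.isLinear.Build K _ _ *:%R tensor_unitl
  (tensor_lift_is_linear tensor_unitl_bilinear).
HB.instance Definition _ := GRing.isLinear.Build K _ _ *:%R tensor_unitr
  (tensor_lift_is_linear tensor_unitr_bilinear).

Lemma tensor_unitlE a v : tensor_unitl (tens a v) = a *: v.
Proof. exact: (tensor_liftE tensor_unitl_bilinear). Qed.

Lemma tensor_unitrE v a : tensor_unitr (tens v a) = a *: v.
Proof. exact: (tensor_liftE tensor_unitr_bilinear). Qed.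
End Unitors.

Record coalgebra (K : fieldType) := Coalgebra {
  coalg_sort :> lmodType K;
  comul : {linear coalg_sort -> tensor coalg_sort coalg_sort};
  counit : {linear coalg_sort -> K^o};
  comulA : forall c, tensor_assoc (tensor_map comul idfun (comul c)) =
                     tensor_map idfun comul (comul c);
  counitl : forall c, tensor_unitl (tensor_map counit idfun (comul c)) = c;
  counitr : forall c, tensor_unitr (tensor_map idfun counit (comul c)) = c }.

Arguments comul {K} _.
Arguments counit {K} _.

Section Comodules.
Variables (K : fieldType) (C : coalgebra K).

Record right_comodule := RightComodule {
  rcomod_sort :> lmodType K;
  coact : {linear rcomod_sort -> tensor rcomod_sort C};
  coactA : forall v, tensor_assoc (tensor_map coact idfun (coact v)) =
                     tensor_map idfun (comul C) (coact v);
  coact_counit : forall v, tensor_unitr (tensor_map idfun (counit C) (coact v)) = v }.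

Definition rcomod_hom (V W : right_comodule) : Type :=
  {f : {linear V -> W} |
    forall v, coact W (f v) = tensor_map f idfun (coact V v)}.

Lemma rcomod_hom_eq V W (f g : rcomod_hom V W) : sval f =1 sval g -> f = g.
Proof. by case: f g => [f hf] [g hg] /= fg; apply/eq_exist/linear_eq. Qed.

Lemma rcomod_id_subproof (V : right_comodule) v :
  coact V (idfun v) = tensor_map idfun idfun (coact V v).
Proof. by rewrite tensor_map_id. Qed.

Definition rcomod_id (V : right_comodule) : rcomod_hom V V :=
  exist _ (idfun : {linear V -> V}) (@rcomod_id_subproof V).

Lemma rcomod_comp_subproof (V W X : right_comodule) (g : rcomod_hom W X)
    (f : rcomod_hom V W) v :
  coact X ((sval g \o sval f) v) =
  tensor_map (sval g \o sval f) idfun (coact V v).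
Proof.
by rewrite /= (svalP g) (svalP f) tensor_map_comp.
Qed.

Definition rcomod_comp (V W X : right_comodule) (g : rcomod_hom W X)
    (f : rcomod_hom V W) : rcomod_hom V X :=
  exist _ (sval g \o sval f : {linear V -> X}) (rcomod_comp_subproof g f).

Definition right_comodules : category.
Proof.
by refine (@Category right_comodule rcomod_hom rcomod_id rcomod_comp _ _ _);
   move=> *; apply: rcomod_hom_eq.
Defined.
End Comodules.

(* falgType excludes the zero algebra, which is allowed here; see             *)
(* fin_algebra_of for the comparison.                                         *)
Record fin_algebra (K : fieldType) := FinAlgebra {
  alg_sort :> vectType K;
  amul : alg_sort -> alg_sort -> alg_sort;
  aone : alg_sort;
  amul_bilinear : is_bilinear amul;
  amulA : associative amul;
  amul1l : left_id aone amul;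
  amul1r : right_id aone amul }.

Arguments amul {K} _.
Arguments aone {K} _.

Lemma falg_mul_bilinear (K : fieldType) (A : falgType K) :
  is_bilinear ( *%R : A -> A -> A).
Proof.
split=> [b|a] k x y; first by rewrite mulrDl scalerAl.
by rewrite mulrDr scalerAr.
Qed.

Definition fin_algebra_of (K : fieldType) (A : falgType K) : fin_algebra K :=
  FinAlgebra (falg_mul_bilinear A) (@mulrA A) (@mul1r A) (@mulr1 A).

Section Modules.
Variables (K : fieldType) (A : fin_algebra K).

(* The K-vector space structure is part of the data; since ract is bilinear   *)
(* and ract1 holds, it is determined by the action of the multiples of aone.  *)
Record right_module := RightModule {
  rmod_sort :> lmodType K;
  ract : rmod_sort -> A -> rmod_sort;
  ract_bilinear : is_bilinear ract;
  ract1 : forall v, ract v (aone A) = v;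
  ractM : forall v a b, ract v (amul A a b) = ract (ract v a) b }.

Definition rmod_hom (V W : right_module) : Type :=
  {f : {linear V -> W} | forall v a, f (ract v a) = ract (f v) a}.

Lemma rmod_hom_eq V W (f g : rmod_hom V W) : sval f =1 sval g -> f = g.
Proof. by case: f g => [f hf] [g hg] /= fg; apply/eq_exist/linear_eq. Qed.

Definition rmod_id (V : right_module) : rmod_hom V V :=
  exist (fun f : {linear V -> V} => forall v a, f (ract v a) = ract (f v) a)
    idfun (fun _ _ => erefl).

Lemma rmod_comp_subproof (V W X : right_module) (g : rmod_hom W X)
    (f : rmod_hom V W) v a :
  (sval g \o sval f) (ract v a) = ract ((sval g \o sval f) v) a.
Proof. by rewrite /= (svalP f) (svalP g). Qed.

Definition rmod_comp (V W X : right_module) (g : rmod_hom W X)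
    (f : rmod_hom V W) : rmod_hom V X :=
  exist _ (sval g \o sval f : {linear V -> X}) (rmod_comp_subproof g f).

Definition right_modules : category.
Proof.
by refine (@Category right_module rmod_hom rmod_id rmod_comp _ _ _);
   move=> *; apply: rmod_hom_eq.
Defined.
End Modules.

Section DualTensor.
Variables (K : fieldType) (V W : vectType K).

Local Notation dual U := 'Hom(U, K^o).

Definition dual_pair (z : dual V) (y : dual W) : tensor V W -> K^o :=
  tensor_lift (fun v w => z v * y w : K^o).

Lemma dual_pair_bilinear (z : dual V) (y : dual W) : is_bilinear (fun (v : V) (w : W) => z v * y w : K^o).
Proof.
split=> [w|v] a u u' /=; rewrite linearP /=; first by rewrite mulrDl -scalerAl.
by rewrite mulrDr -scalerAr.
Qed.

HB.instance Definition _ z y := GRing.isLinear.Build K _ _ *:%R (dual_pair z y)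
  (tensor_lift_is_linear (dual_pair_bilinear z y)).

Lemma dual_pairE z y v w : dual_pair z y (tens v w) = z v * y w.
Proof. exact: (tensor_liftE (dual_pair_bilinear z y)). Qed.

(* The identification of V^* (x) W^* with the dual of V (x) W that sends       *)
(* z (x) y to v (x) w |-> z v * y w.                                          *)
Definition dual_tensor (x : tensor (dual V) (dual W)) (t : tensor V W) : K^o :=
  tensor_lift (fun z y => dual_pair z y t) x.

Lemma dual_tensor_bilinear_aux t : is_bilinear (fun z y => dual_pair z y t).
Proof.
split=> [y|z] a u u'; elim/tensor_ind: t => [|v w t IH].
- by rewrite !linear0 addr0.
- rewrite !(linearD (dual_pair _ _)) /= IH scalerDr addrACA; congr (_ + _).
  by rewrite !dual_pairE !lfunE /= lfunE /= mulrDl -scalerAl.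
- by rewrite !linear0 addr0.
- rewrite !(linearD (dual_pair _ _)) /= IH scalerDr addrACA; congr (_ + _).
  by rewrite !dual_pairE !lfunE /= lfunE /= mulrDr -scalerAr.
Qed.

Lemma dual_tensor_tens z y t : dual_tensor (tens z y) t = dual_pair z y t.
Proof. exact: (tensor_liftE (dual_tensor_bilinear_aux t)). Qed.

Lemma dual_tensor_bilinear : is_bilinear dual_tensor.
Proof.
split=> [t|x] a u u'.
  exact: (tensor_lift_is_linear (dual_tensor_bilinear_aux t)).
elim/tensor_ind: x => [|z y x IH].
  have l0 t : dual_tensor 0 t = 0.
    have := tensor_lift_is_linear (dual_tensor_bilinear_aux t) (-1) 0 0.
    by rewrite scaler0 addr0 scaleN1r addNr.
  by rewrite !l0 scaler0 addr0.
have lD t : dual_tensor (tens z y + x) t = dual_pair z y t + dual_tensor x t.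
  have := tensor_lift_is_linear (dual_tensor_bilinear_aux t) 1 (tens z y) x.
  by rewrite !scale1r [tensor_lift _ (tens _ _)]dual_tensor_tens.
by rewrite !lD IH linearP scalerDr addrACA.
Qed.

Definition dual_basis (U : vectType K) (i : 'I_(\dim (fullv : {vspace U}))) :
  dual U := linfun (coord (vbasis fullv) i : U -> K^o).

Arguments dual_basis : clear implicits.

Lemma dual_basisE (U : vectType K) (z : dual U) :
  z = \sum_(i < \dim (fullv : {vspace U})) z (vbasis fullv)`_i *: dual_basis U i.
Proof.
apply/lfunP => u; rewrite sum_lfunE [in LHS](coord_vbasis (memvf u)) linear_sum.
apply: eq_bigr => i _; rewrite linearZ !lfunE /= !lfunE /=; apply: mulrC.
Qed.

(* The inverse of the bijection dual_tensor, by dual_tensorK and              *)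
(* dual_tensor_invK.                                                          *)
Definition dual_tensor_inv (f : tensor V W -> K^o) : tensor (dual V) (dual W) :=
  \sum_(i < \dim (fullv : {vspace V})) \sum_(j < \dim (fullv : {vspace W}))
    f (tens (vbasis fullv)`_i (vbasis fullv)`_j) *:
    tens (dual_basis V i) (dual_basis W j).

Lemma tens_suml I (r : seq I) (X Y : lmodType K) (F : I -> X) (y : Y) :
  tens (\sum_(i <- r) F i) y = \sum_(i <- r) tens (F i) y.
Proof.
elim: r => [|i r IH]; first by rewrite !big_nil (bilin0l (tens_bilinear _ _)).
by rewrite !big_cons (bilinDl (tens_bilinear _ _)) IH.
Qed.

Lemma tens_sumr I (r : seq I) (X Y : lmodType K) (F : I -> Y) (x : X) :
  tens x (\sum_(i <- r) F i) = \sum_(i <- r) tens x (F i).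
Proof.
elim: r => [|i r IH]; first by rewrite !big_nil (bilin0r (tens_bilinear _ _)).
by rewrite !big_cons (bilinDr (tens_bilinear _ _)) IH.
Qed.

Lemma dual_tensor_inv_linear (a : K) (f g h : tensor V W -> K^o) :
  (forall t, h t = a *: f t + g t) ->
  dual_tensor_inv h = a *: dual_tensor_inv f + dual_tensor_inv g.
Proof.
move=> hE; rewrite /dual_tensor_inv scaler_sumr -big_split /=.
apply: eq_bigr => i _; rewrite scaler_sumr -big_split /=.
by apply: eq_bigr => j _; rewrite hE scalerDl scalerA.
Qed.

Lemma dual_tensorK x : dual_tensor_inv (dual_tensor x) = x.
Proof.
elim/tensor_ind: x => [|z y x IH].
  rewrite /dual_tensor_inv big1 // => i _; rewrite big1 // => j _.
  by rewrite (bilin0l dual_tensor_bilinear) scale0r.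
rewrite (@dual_tensor_inv_linear 1 (dual_pair z y) (dual_tensor x)); last first.
  by move=> t; rewrite (bilinDl dual_tensor_bilinear) dual_tensor_tens scale1r.
rewrite IH scale1r; congr (_ + _).
rewrite [in RHS](dual_basisE z) tens_suml; apply: eq_bigr => i _.
rewrite [in RHS](dual_basisE y) tens_sumr; apply: eq_bigr => j _.
by rewrite dual_pairE (bilinZl (tens_bilinear _ _)) (bilinZr (tens_bilinear _ _)) scalerA.
Qed.

Lemma dual_tensor_invK (f : {linear tensor V W -> K^o}) t :
  dual_tensor (dual_tensor_inv f) t = f t.
Proof.
have dsum I (r : seq I) F u :
    dual_tensor (\sum_(i <- r) F i) u = \sum_(i <- r) dual_tensor (F i) u.
  elim: r => [|i r IH]; first by rewrite !big_nil (bilin0l dual_tensor_bilinear).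
  by rewrite !big_cons (bilinDl dual_tensor_bilinear) IH.
elim/tensor_ind: t => [|v w t IH].
  by rewrite (bilin0r dual_tensor_bilinear) linear0.
rewrite (bilinDr dual_tensor_bilinear) linearD IH; congr (_ + _).
rewrite dsum [in RHS](coord_vbasis (memvf v)) tens_suml linear_sum.
apply: eq_bigr => i _.
rewrite dsum [in RHS](coord_vbasis (memvf w)) tens_sumr linear_sum.
apply: eq_bigr => j _.
rewrite (bilinZl dual_tensor_bilinear) dual_tensor_tens dual_pairE.
rewrite (bilinZl (tens_bilinear _ _)) (bilinZr (tens_bilinear _ _)).
rewrite !linearZ /= !lfunE /=; congr (_ *: _); apply: mulrC.
Qed.
End DualTensor.

Section FrobeniusDef.
Variables (K : fieldType) (A : fin_algebra K).

Local Notation dual := 'Hom(A, K^o).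

Definition ramul (a b : A) : A := amul A b a.

Lemma ramul_is_linear a : linear (ramul a).
Proof. exact: (amul_bilinear A).1. Qed.

HB.instance Definition _ a :=
  GRing.isLinear.Build K _ _ *:%R (ramul a) (ramul_is_linear a).

(* The left action (a . z)(b) = z (b a) of A on its dual. *)
Definition dual_lact (a : A) (z : dual) : dual := (z \o linfun (ramul a))%VF.

Lemma dual_lactE a z b : dual_lact a z b = z (amul A b a).
Proof. by rewrite /dual_lact comp_lfunE lfunE. Qed.

Record frobenius := Frobenius {
  frob_iso :> 'Hom(A, dual);
  frob_iso_bij : bijective frob_iso;
  frob_iso_lmod : forall a b, frob_iso (amul A a b) = dual_lact a (frob_iso b) }.
End FrobeniusDef.

Section FrobeniusCoalgebra.
Variables (K : fieldType) (A : fin_algebra K) (lambda : frobenius A).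

Local Notation dual := 'Hom(A, K^o).

Definition frob_counit : A -> K^o := lambda (aone A).

HB.instance Definition _ := GRing.Linear.on frob_counit.

Definition op_mul : tensor A A -> A := tensor_lift (fun a b => amul A b a).

Lemma op_mul_bilinear : is_bilinear (fun a b => amul A b a).
Proof. by case: (amul_bilinear A) => h1 h2; split. Qed.

HB.instance Definition _ := GRing.isLinear.Build K _ _ *:%R op_mul
  (tensor_lift_is_linear op_mul_bilinear).

Lemma op_mulE a b : op_mul (tens a b) = amul A b a.
Proof. exact: (tensor_liftE op_mul_bilinear). Qed.

Definition frob_inv : dual -> A := (lambda^-1)%VF.

HB.instance Definition _ := GRing.Linear.on frob_inv.

Lemma frob_invK : cancel frob_inv lambda.
Proof.
have [g gK Kg] := frob_iso_bij lambda => z.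
by rewrite -[z]Kg /frob_inv lker0_lfunK //; apply/lker0P/(can_inj gK).
Qed.

Lemma frobK : cancel lambda frob_inv.
Proof.
have [g gK Kg] := frob_iso_bij lambda => a.
by rewrite /frob_inv lker0_lfunK //; apply/lker0P/(can_inj gK).
Qed.

(* (lambda^-1 (x) lambda^-1) \o op_mul^* \o lambda *)
Definition frob_comul (a : A) : tensor A A :=
  tensor_map frob_inv frob_inv (dual_tensor_inv (lambda a \o op_mul)).

Lemma frob_comul_is_linear : linear frob_comul.
Proof.
move=> k a b; rewrite /frob_comul -linearP; congr (tensor_map _ _ _).
by apply: dual_tensor_inv_linear => t; rewrite /= linearP !lfunE /= !lfunE.
Qed.

HB.instance Definition _ :=
  GRing.isLinear.Build K _ _ *:%R frob_comul frob_comul_is_linear.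

Lemma frob_comulE a t :
  dual_tensor (tensor_map lambda lambda (frob_comul a)) t = lambda a (op_mul t).
Proof.
rewrite /frob_comul; set x := dual_tensor_inv _.
have -> : tensor_map lambda lambda (tensor_map frob_inv frob_inv x) = x.
  move: x; apply: (@tensor_ext _ _ _ _
    (tensor_map lambda lambda \o tensor_map frob_inv frob_inv) idfun) => z y /=.
  by rewrite !tensor_mapE /= !frob_invK.
exact: (dual_tensor_invK (lambda a \o op_mul)).
Qed.

Definition frob_eval (x b : A) : K^o := lambda b x.

Lemma frob_eval_is_linear x : linear (frob_eval x).
Proof. by move=> k a b; rewrite /frob_eval linearP !lfunE /= lfunE. Qed.

HB.instance Definition _ x :=
  GRing.isLinear.Build K _ _ *:%R (frob_eval x) (frob_eval_is_linear x).

Definition contr (W : lmodType K) (x : A) : tensor A W -> W :=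
  tensor_unitl (V:=W) \o tensor_map (frob_eval x) idfun.

HB.instance Definition _ W x := GRing.Linear.on (@contr W x).

Lemma contrE W x b w : @contr W x (tens b w) = lambda b x *: w.
Proof. by rewrite /contr /= tensor_mapE tensor_unitlE. Qed.

Lemma contr_inj W (t t' : tensor A W) :
  (forall x, contr x t = contr x t') -> t = t'.
Proof.
have tE u : u = \sum_(i < \dim (fullv : {vspace A}))
    tens (frob_inv (@dual_basis K A i)) (contr (vbasis fullv)`_i u) :> tensor A W.
  elim/tensor_ind: u => [|a w u {1}->].
    by rewrite big1 // => i _; rewrite linear0 (bilin0r (tens_bilinear _ _)).
  rewrite -{1}[a]frobK [lambda a]dual_basisE linear_sum tens_suml -big_split /=.
  apply: eq_bigr => i _; rewrite linearD (bilinDr (tens_bilinear _ _)); congr (_ + _).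
  rewrite /= contrE linearZ /=.
  by rewrite (bilinZr (tens_bilinear _ _)) (bilinZl (tens_bilinear _ _)).
by move=> h; rewrite [t]tE [t']tE; apply: eq_bigr => i _; rewrite h.
Qed.

Lemma contr_comul x a : contr x (frob_comul a) = amul A x a.
Proof.
apply: (can_inj frobK); apply/lfunP => y.
have -> t : lambda (contr x t) y =
    dual_tensor (tensor_map lambda lambda t) (tens x y).
  elim/tensor_ind: t => [|b c t IH].
    by rewrite !linear0 lfunE (bilin0l (@dual_tensor_bilinear _ _ _)).
  rewrite !linearD /= !lfunE /= (bilinDl (@dual_tensor_bilinear _ _ _)) IH.
  rewrite contrE tensor_mapE dual_tensor_tens dual_pairE linearZ /= lfunE /=.
  by [].
by rewrite frob_comulE op_mulE frob_iso_lmod dual_lactE.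
Qed.

Definition lamul (x b : A) : A := amul A x b.

Lemma lamul_is_linear x : linear (lamul x).
Proof. exact: (amul_bilinear A).2. Qed.

HB.instance Definition _ x :=
  GRing.isLinear.Build K _ _ *:%R (lamul x) (lamul_is_linear x).

Lemma frob_comul_lmod x a :
  frob_comul (amul A x a) = tensor_map (lamul x) idfun (frob_comul a).
Proof.
apply: contr_inj => y.
have -> t : contr y (tensor_map (lamul x) idfun t) = @contr A (amul A y x) t.
  elim/tensor_ind: t => [|b c t IH]; first by rewrite !linear0.
  by rewrite !linearD /= IH tensor_mapE !contrE frob_iso_lmod dual_lactE.
by rewrite !contr_comul amulA.
Qed.

Lemma frob_comulA a :
  tensor_assoc (tensor_map frob_comul idfun (frob_comul a)) =
  tensor_map idfun frob_comul (frob_comul a).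
Proof.
apply: contr_inj => x.
have -> t : contr x (tensor_assoc t) =
    tensor_map (@contr A x) (idfun : {linear A -> A}) t.
  elim/tensor_ind: t => [|u c t IH]; first by rewrite !linear0.
  rewrite !linearD /= IH tensor_mapE; congr (_ + _).
  elim/tensor_ind: u => [|b d u {}IH].
    by rewrite !(linear0, bilin0l (tens_bilinear _ _)).
  rewrite !(linearD, bilinDl (tens_bilinear _ _)) /= IH; congr (_ + _).
  by rewrite tensor_assocE !contrE (bilinZl (tens_bilinear _ _)).
have -> t : tensor_map (@contr A x) (idfun : {linear A -> A})
    (tensor_map frob_comul idfun t) = tensor_map (lamul x) idfun t.
  elim/tensor_ind: t => [|b c t IH]; first by rewrite !linear0.
  by rewrite !linearD /= IH !tensor_mapE /= contr_comul.
have -> t : contr x (tensor_map idfun frob_comul t) = frob_comul (@contr A x t).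
  elim/tensor_ind: t => [|b c t IH]; first by rewrite !linear0.
  by rewrite !linearD /= IH tensor_mapE !contrE linearZ.
by rewrite contr_comul frob_comul_lmod.
Qed.

Lemma frob_counitl a : tensor_unitl (tensor_map frob_counit idfun (frob_comul a)) = a.
Proof.
have -> t : tensor_unitl (tensor_map frob_counit idfun t) = @contr A (aone A) t.
  elim/tensor_ind: t => [|b c t IH]; first by rewrite !linear0.
  rewrite !linearD /= IH tensor_mapE tensor_unitlE contrE; congr (_ *: _ + _).
  by rewrite /frob_counit -[b in RHS]amul1r frob_iso_lmod dual_lactE amul1l.
by rewrite contr_comul amul1l.
Qed.

Lemma frob_counitr a : tensor_unitr (tensor_map idfun frob_counit (frob_comul a)) = a.
Proof.
apply: (can_inj frobK); apply/lfunP => x.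
have -> t : lambda (tensor_unitr (tensor_map idfun frob_counit t)) x =
    frob_counit (contr x t).
  elim/tensor_ind: t => [|b c t IH]; first by rewrite !linear0 lfunE.
  rewrite !linearD /= lfunE /= IH tensor_mapE tensor_unitrE contrE; congr (_ + _).
  by rewrite !linearZ /= lfunE /=; apply: mulrC.
by rewrite contr_comul /frob_counit -[a in RHS]amul1r frob_iso_lmod dual_lactE.
Qed.

Definition frobenius_coalgebra : coalgebra K :=
  Coalgebra frob_comulA frob_counitl frob_counitr.
End FrobeniusCoalgebra.

(* Main.v *)
(* Write e = \sum e' (x) e'' for delta(1).  A right action gives the coaction
   v |-> \sum v e' (x) e'', and a coaction v |-> \sum v_0 (x) v_1 gives the
   action v.a = \sum v_0 epsilon(v_1 a).  The two constructions are mutually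
   inverse because \sum e' epsilon(e'' a) = a and \sum epsilon(x e') e'' = x;
   both leave the underlying vector space and the underlying linear maps
   unchanged, hence the isomorphism of categories. *)
Require Import Defs.
From mathcomp Require Import all_boot all_algebra.
From HB Require Import structures.
From mathcomp Require Import boolp.

Set Implicit Arguments.
Unset Strict Implicit.
Unset Printing Implicit Defensive.

Import GRing.Theory.

Local Open Scope ring_scope.

(** * Equality of functors *)

Lemma existT_inj (T : Type) (P : T -> Type) (x : T) (p q : P x) :
  existT P x p = existT P x q -> p = q.
Proof.
by move=> pq; have := projT2_eq pq; rewrite (Prop_irrelevance (projT1_eq pq) erefl).
Qed.

(** The types of [fmap F f] and [fmap G f] depend on the object maps, so morphisms are compared
    together with their endpoints. Once the object maps are identified, [existT_inj] removes the
    endpoints. *)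
Lemma functor_eq (C D : category) (F G : functor C D) :
  (forall X, F X = G X) ->
  (forall (X Y : C) (f : Defs.hom X Y),
    existT (fun p : D * D => Defs.hom p.1 p.2) (F X, F Y) (fmap F f) =
    existT (fun p : D * D => Defs.hom p.1 p.2) (G X, G Y) (fmap G f)) ->
  F = G.
Proof.
case: F G => [F Ff Fid Fcomp] [G Gf Gid Gcomp] /= /funext FG; subst G => fg.
have FfE : Ff = Gf.
  apply: functional_extensionality_dep => X.
  apply: functional_extensionality_dep => Y.
  by apply: functional_extensionality_dep => f; apply: existT_inj (fg X Y f).
by subst Gf; congr Functor; apply: Prop_irrelevance.
Qed.

(** * Right linearity of $\delta$ and contraction of the second tensor factor *)

Section RightMultiplication.
Variables (K : fieldType) (A : fin_algebra K) (lambda : frobenius A).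

(** Contractions of the first factor separate tensors, and contracting either side with $y$ gives
    $yca$. *)
Lemma frob_comul_rmod c a :
  frob_comul lambda (amul A c a) =
  tensor_map idfun (ramul a) (frob_comul lambda c).
Proof.
apply: (@contr_inj _ _ lambda) => y.
have -> t : contr lambda y (tensor_map idfun (ramul a) t) =
    ramul a (contr lambda y t) :> A.
  elim/tensor_ind: t => [|b d t IH]; first by rewrite !linear0.
  by rewrite !linearD /= IH tensor_mapE !contrE linearZ.
by rewrite !contr_comul /ramul amulA.
Qed.

(** The map $v \otimes b \mapsto \epsilon(ba) v$ (see [frob_isoE]), mirror image of [contr]. *)
Definition cocontr (V : lmodType K) (a : A) : tensor V A -> V :=
  tensor_unitr (V:=V) \o tensor_map idfun (lambda a).

HB.instance Definition _ V a := GRing.Linear.on (@cocontr V a).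

Lemma cocontrE (V : lmodType K) a v b : @cocontr V a (tens v b) = lambda a b *: v.
Proof. by rewrite /cocontr /= tensor_mapE tensor_unitrE. Qed.

Lemma cocontr_bilinear (V : lmodType K) :
  is_bilinear (fun t a => @cocontr V a t).
Proof.
split=> [a|t] k x y; first exact: linearP.
elim/tensor_ind: t => [|v b t IH]; first by rewrite !linear0 addr0.
rewrite !(linearD (@cocontr _ _)) /= IH scalerDr addrACA; congr (_ + _).
by rewrite !cocontrE linearP !lfunE /= lfunE /= scalerDl scalerA.
Qed.

Lemma frob_isoE a x : lambda a x = frob_counit lambda (amul A x a).
Proof. by rewrite /frob_counit -{1}[a]amul1r frob_iso_lmod dual_lactE. Qed.

(** By right linearity the left side is $(id \otimes \epsilon)\delta(ca)$, so the right counit law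
    applies. For $c = 1$ this reads $\sum e' \epsilon(e'' a) = a$. *)
Lemma cocontr_comul a c : cocontr a (frob_comul lambda c) = amul A c a.
Proof.
rewrite -[RHS](frob_counitr lambda) frob_comul_rmod.
elim/tensor_ind: (frob_comul _ _) => [|b d t IH]; first by rewrite !linear0.
by rewrite !linearD /= IH cocontrE !tensor_mapE tensor_unitrE frob_isoE.
Qed.

Lemma cocontr_map (V W : lmodType K) (f : {linear V -> W}) a t :
  cocontr a (tensor_map f idfun t) = f (cocontr a t).
Proof.
elim/tensor_ind: t => [|v b t IH]; first by rewrite !linear0.
by rewrite !linearD /= IH tensor_mapE !cocontrE linearZ.
Qed.

Definition cocontr_flip (V : lmodType K) (t : tensor V A) (a : A) : V := cocontr a t.

HB.instance Definition _ V t := GRing.isLinear.Build K _ _ *:%R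
  (@cocontr_flip V t) ((cocontr_bilinear V).2 t).

(** For $t = v \otimes x$ the left side is $v \otimes \sum \epsilon(x e') e''$, and that sum is
    [contr] of $\delta(1)$ at $x$, which is $x$. Applied to a coaction, this recovers it from the
    induced action. *)
Lemma cocontr_flip_comul1 (V : lmodType K) (t : tensor V A) :
  tensor_map (cocontr_flip t) idfun (frob_comul lambda (aone A)) = t.
Proof.
elim/tensor_ind: t => [|v x t IHt].
  elim/tensor_ind: (frob_comul _ _) => [|b c t IH]; first by rewrite linear0.
  rewrite linearD /= IH addr0 tensor_mapE /= /cocontr_flip linear0.
  by rewrite (bilin0l (tens_bilinear _ _)).
(* Both sides become linear in the same $\delta(1)$, which can then be replaced by an arbitrary
   tensor. *)
rewrite -[x in RHS]amul1r -(contr_comul lambda) -[t in RHS]IHt {IHt}.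
elim/tensor_ind: (frob_comul _ _) => [|b c u IH].
  by rewrite !linear0 (bilin0r (tens_bilinear _ _)) add0r.
rewrite !(linearD (tensor_map _ _)) /= IH linearD (bilinDr (tens_bilinear _ _)).
rewrite addrACA; congr (_ + _).
rewrite !tensor_mapE /= /cocontr_flip linearD (bilinDl (tens_bilinear _ _)).
rewrite /= cocontrE contrE.
by rewrite (bilinZl (tens_bilinear _ _)) (bilinZr (tens_bilinear _ _)).
Qed.
End RightMultiplication.

(** * From modules to comodules *)

Section ModuleToComodule.
Variables (K : fieldType) (A : fin_algebra K) (lambda : frobenius A).

Section Objects.
Variable V : right_module A.

Definition orbit_map (v : V) (a : A) : V := ract v a.

Lemma orbit_map_is_linear v : linear (orbit_map v).
Proof. exact: (ract_bilinear V).2. Qed.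

HB.instance Definition _ v :=
  GRing.isLinear.Build K _ _ *:%R (orbit_map v) (orbit_map_is_linear v).

Definition module_coact (v : V) : tensor V A :=
  tensor_map (orbit_map v) idfun (frob_comul lambda (aone A)).

Lemma module_coact_is_linear : linear module_coact.
Proof.
move=> k v w; rewrite /module_coact.
elim/tensor_ind: (frob_comul _ _) => [|b c t IH].
  by rewrite !linear0 addr0.
rewrite !(linearD (tensor_map _ _)) /= IH scalerDr addrACA; congr (_ + _).
by rewrite !tensor_mapE /= /orbit_map (ract_bilinear V).1 (tens_bilinear _ _).1.
Qed.

HB.instance Definition _ := GRing.isLinear.Build K _ _ *:%R module_coact
  module_coact_is_linear.

(** Left linearity gives $a\delta(1) = \delta(a)$. *)
Lemma module_coact_ract v a :
  module_coact (ract v a) = tensor_map (orbit_map v) idfun (frob_comul lambda a).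
Proof.
rewrite /module_coact -[X in _ = tensor_map _ _ (frob_comul _ X)]amul1r.
rewrite frob_comul_lmod.
elim/tensor_ind: (frob_comul _ _) => [|b c t IH]; first by rewrite !linear0.
by rewrite !linearD /= IH !tensor_mapE /= /orbit_map /lamul ractM.
Qed.

(** By [module_coact_ract] the left side is $(\delta \otimes id)\delta(1)$, reassociated, with its
    first factor acting on $v$; coassociativity of $\delta$ concludes. *)
Lemma module_coactA v :
  tensor_assoc (tensor_map module_coact idfun (module_coact v)) =
  tensor_map idfun (frob_comul lambda) (module_coact v).
Proof.
rewrite {2 3}/module_coact.
have -> t : tensor_assoc
      (tensor_map module_coact idfun (tensor_map (orbit_map v) idfun t)) =
    tensor_map (orbit_map v) idfun
      (tensor_assoc (tensor_map (frob_comul lambda) idfun t))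
      :> tensor V (tensor A A).
  elim/tensor_ind: t => [|b c t IH]; first by rewrite !linear0.
  rewrite !linearD /= IH !tensor_mapE; congr (_ + _).
  rewrite /= {1}/orbit_map module_coact_ract.
  elim/tensor_ind: (frob_comul _ _) => [|d e u IHu].
    by rewrite !(linear0, bilin0l (tens_bilinear _ _)).
  rewrite !(linearD, bilinDl (tens_bilinear _ _)) /= IHu; congr (_ + _).
  by rewrite tensor_mapE !tensor_assocE tensor_mapE.
rewrite frob_comulA.
elim/tensor_ind: (frob_comul _ _) => [|b c t IH]; first by rewrite !linear0.
by rewrite !linearD /= IH !tensor_mapE.
Qed.

Lemma cocontr_module_coact a v : cocontr lambda a (module_coact v) = ract v a.
Proof. by rewrite /module_coact cocontr_map cocontr_comul amul1l. Qed.

(** By definition, $id \otimes \epsilon$ is [cocontr] at $a = 1$. *)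
Lemma module_coact_counit v :
  tensor_unitr (tensor_map idfun (frob_counit lambda) (module_coact v)) = v.
Proof. by rewrite -[RHS]ract1 -cocontr_module_coact. Qed.

Definition comodule_of_module : right_comodule (frobenius_coalgebra lambda) :=
  RightComodule (C := frobenius_coalgebra lambda) (coact := module_coact)
    module_coactA module_coact_counit.
End Objects.

Lemma module_coact_hom (V W : right_module A) (f : rmod_hom V W) v :
  module_coact (sval f v) = tensor_map (sval f) idfun (module_coact v).
Proof.
rewrite /module_coact.
elim/tensor_ind: (frob_comul _ _) => [|b c t IH]; first by rewrite !linear0.
by rewrite !linearD /= IH !tensor_mapE /= /orbit_map (svalP f).
Qed.

Definition comodule_hom_of_module (V W : right_module A) (f : rmod_hom V W) :
    rcomod_hom (comodule_of_module V) (comodule_of_module W) :=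
  exist _ (sval f) (module_coact_hom f).

Definition comodule_functor :
  functor (right_modules A) (right_comodules (frobenius_coalgebra lambda)).
Proof.
by apply: (@Functor (right_modules A) (right_comodules (frobenius_coalgebra lambda))
  comodule_of_module comodule_hom_of_module) => *; apply: rcomod_hom_eq.
Defined.

End ModuleToComodule.

(** * From comodules to modules *)

Section ComoduleToModule.
Variables (K : fieldType) (A : fin_algebra K) (lambda : frobenius A).
Local Notation C := (frobenius_coalgebra lambda).

Section Objects.
Variable V : right_comodule C.

Definition comodule_ract (v : V) (a : A) : V := cocontr lambda a (coact V v).

Lemma comodule_ract_bilinear : is_bilinear comodule_ract.
Proof.
split=> [a|v] k x y; last exact: (cocontr_bilinear lambda V).2.
by rewrite /comodule_ract linearP; apply: linearP.
Qed.

Lemma comodule_ract1 v : comodule_ract v (aone A) = v.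
Proof. exact: (coact_counit v). Qed.

(** The right side is $\sum v_0 \epsilon(v_1 b) \epsilon(v_2 a)$. By coassociativity $v_1 \otimes
    v_2$ comes from $\delta(v_1)$, and $\sum x' \epsilon(x'' a) = xa$ turns it into $\sum v_0
    \epsilon(v_1 ab)$. *)
Lemma comodule_ractM v a b :
  comodule_ract v (amul A a b) = comodule_ract (comodule_ract v a) b.
Proof.
rewrite /comodule_ract -(cocontr_map lambda (coact V)).
(* Reassociating first lets $a$ contract inside $A \otimes A$, where [cocontr_comul] applies. *)
have -> t : cocontr lambda b (cocontr lambda a t) =
    cocontr lambda b (tensor_map idfun (@cocontr _ _ lambda A a) (tensor_assoc t)).
  elim/tensor_ind: t => [|u y t IH]; first by rewrite !linear0.
  rewrite !linearD /= IH; congr (_ + _).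
  elim/tensor_ind: u => [|w x u IHu].
    by rewrite (bilin0l (tens_bilinear _ _)) !linear0.
  rewrite (bilinDl (tens_bilinear _ _)) !linearD /= IHu; congr (_ + _).
  by rewrite tensor_assocE tensor_mapE /= !cocontrE !linearZ /= cocontrE scalerA.
rewrite coactA; elim/tensor_ind: (coact V v) => [|w x t IH].
  by rewrite !linear0.
rewrite !linearD /= {}IH !tensor_mapE /= cocontr_comul !cocontrE; congr (_ *: _ + _).
by rewrite !frob_isoE amulA.
Qed.

Definition module_of_comodule : right_module A :=
  RightModule comodule_ract_bilinear comodule_ract1 comodule_ractM.
End Objects.

Lemma comodule_ract_hom (V W : right_comodule C) (f : rcomod_hom V W) v a :
  sval f (comodule_ract v a) = comodule_ract (sval f v) a.
Proof. by rewrite /comodule_ract (svalP f) cocontr_map. Qed.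

Definition module_hom_of_comodule (V W : right_comodule C) (f : rcomod_hom V W) :
    rmod_hom (module_of_comodule V) (module_of_comodule W) :=
  exist _ (sval f) (comodule_ract_hom f).

Definition module_functor : functor (right_comodules C) (right_modules A).
Proof.
by apply: (@Functor (right_comodules C) (right_modules A)
  module_of_comodule module_hom_of_comodule) => *; apply: rmod_hom_eq.
Defined.

(** The induced action on $v$ is, by definition, [cocontr_flip] of the coaction of $v$. *)
Lemma module_coact_comodule_ract (V : right_comodule C) v :
  module_coact lambda (V := module_of_comodule V) v = coact V v.
Proof.
rewrite -[RHS](cocontr_flip_comul1 lambda) /module_coact.
elim/tensor_ind: (frob_comul _ _) => [|b c t IH]; first by rewrite !linear0.
by rewrite !linearD /= IH !tensor_mapE.
Qed.

End ComoduleToModule.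

(** * Equality of objects and morphisms, and the isomorphism *)

Lemma right_module_eq (K : fieldType) (A : fin_algebra K) (V : lmodType K)
    (r r' : V -> A -> V) b b' u u' m m' : r = r' ->
  @RightModule K A V r b u m = @RightModule K A V r' b' u' m'.
Proof. by move=> rr'; subst r'; congr RightModule; apply: Prop_irrelevance. Qed.

Lemma right_comodule_eq (K : fieldType) (C : coalgebra K) (V : lmodType K)
    (r r' : {linear V -> tensor V C}) a a' c c' : r = r' ->
  @RightComodule K C V r a c = @RightComodule K C V r' a' c'.
Proof. by move=> rr'; subst r'; congr RightComodule; apply: Prop_irrelevance. Qed.

Section HomEq.
Variables (K : fieldType) (A : fin_algebra K) (V W : lmodType K).
Variables (r r' : V -> A -> V) (s s' : W -> A -> W).

(** Stated on explicit constructors over fixed carriers, so that the actions can be substituted and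
    the proofs of the laws identified by irrelevance; only then do both morphisms have the same
    type. *)
Lemma right_module_hom_eq b b' u u' m m' c c' w w' n n'
    (f : rmod_hom (@RightModule K A V r b u m) (@RightModule K A W s c w n))
    (f' : rmod_hom (@RightModule K A V r' b' u' m') (@RightModule K A W s' c' w' n')) :
  r = r' -> s = s' -> sval f =1 sval f' ->
  existT (fun p : right_module A * right_module A => rmod_hom p.1 p.2) (_, _) f =
  existT (fun p : right_module A * right_module A => rmod_hom p.1 p.2) (_, _) f'.
Proof.
move=> rr' ss'; subst r' s'.
move: f'; rewrite (Prop_irrelevance b' b) (Prop_irrelevance u' u).
rewrite (Prop_irrelevance m' m) (Prop_irrelevance c' c) (Prop_irrelevance w' w).
by rewrite (Prop_irrelevance n' n) => f' ff'; congr existT; apply: rmod_hom_eq.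
Qed.
End HomEq.

Section ComoduleHomEq.
Variables (K : fieldType) (C : coalgebra K) (V W : lmodType K).
Variables (r r' : {linear V -> tensor V C}) (s s' : {linear W -> tensor W C}).

Lemma right_comodule_hom_eq a a' u u' b b' w w'
    (f : rcomod_hom (@RightComodule K C V r a u) (@RightComodule K C W s b w))
    (f' : rcomod_hom (@RightComodule K C V r' a' u') (@RightComodule K C W s' b' w')) :
  r = r' -> s = s' -> sval f =1 sval f' ->
  existT (fun p : right_comodule C * right_comodule C => rcomod_hom p.1 p.2) (_, _) f =
  existT (fun p : right_comodule C * right_comodule C => rcomod_hom p.1 p.2) (_, _) f'.
Proof.
move=> rr' ss'; subst r' s'.
move: f'; rewrite (Prop_irrelevance a' a) (Prop_irrelevance u' u).
rewrite (Prop_irrelevance b' b) (Prop_irrelevance w' w) => f' ff'.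
by congr existT; apply: rcomod_hom_eq.
Qed.
End ComoduleHomEq.

Theorem theorem3p3 (K : fieldType) (A : fin_algebra K) (lambda : frobenius A) :
  isomorphic_categories (right_modules A)
    (right_comodules (frobenius_coalgebra lambda)).
Proof.
(* Well typed because the round trip leaves the carrier convertible to that of [V]. *)
have ractE (V : right_module A) :
    comodule_ract (lambda := lambda) (V := comodule_of_module lambda V) = ract (r := V).
  by apply/funext => v; apply/funext => a; apply: cocontr_module_coact.
have coactE (V : right_comodule (frobenius_coalgebra lambda)) :
    coact (comodule_of_module lambda (module_of_comodule V)) = coact V.
  by apply: linear_eq => v; apply: module_coact_comodule_ract.
exists (comodule_functor lambda), (module_functor lambda); split.
- apply: functor_eq => [V | V W f].
    (* Destructing [V] exposes the constructor that [right_module_eq] requires on both sides. *)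
    by move: (ractE V); case: V => *; apply: right_module_eq.
  move: (ractE V) (ractE W); case: V W f => [V ? ? ? ?] [W ? ? ? ?] f ? ?.
  exact: right_module_hom_eq.
- apply: functor_eq => [V | V W f].
    by move: (coactE V); case: V => *; apply: right_comodule_eq.
  move: (coactE V) (coactE W); case: V W f => [V ? ? ?] [W ? ? ?] f ? ?.
  exact: right_comodule_hom_eq.
Qed.
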